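(* Let $R$ be a finite $\mathbb{R}$-circle in $\partial\mathbf{H}^2_{\mathbb{C}}$, fixed by the anti-holomorphic involution $\iota_R$. Let $r$ be the Cygan distance from $\iota_R(\infty)$ to any point of $R$ (this is the same for all points of $R$). For $\alpha\in[0,\pi/2]$, let $p_\alpha$ be a point on $R$ with $\mathbb{A}(p_\alpha,\iota_R(\infty),\infty)=2\alpha-\pi/2$. Then the maximum Cygan distance from $p_\alpha$ to any other point of $R$ is given by $$d_\alpha(R)=2^{1/2}\,r\,\bigl(\cos^{2/3}(\alpha)+\sin^{2/3}(\alpha)\bigr)^{3/4}.$$
   Context: Let $\langle \mathbf{z},\mathbf{w}\rangle=\bar w_3z_1+\bar w_2z_2+\bar w_1z_3$ on $\mathbb{C}^3$, of signature $(2,1)$. Complex hyperbolic space $\mathbf{H}^2_{\mathbb{C}}$ is the projectivisation of the set of negative vectors and $\partial\mathbf{H}^2_{\mathbb{C}}$ is the projectivisation of the set of non-zero null vectors. The point $\infty\in\partial\mathbf{H}^2_{\mathbb{C}}$ is the class of $\mathbf{q}_\infty=(1,0,0)^t$ (its standard lift). The set $\partial\mathbf{H}^2_{\mathbb{C}}\setminus\{\infty\}$ is identified with the Heisenberg group $\mathbb{C}\times\mathbb{R}$: the point $(\zeta,v)$ has standard lift $(-|\zeta|^2+iv,\ \sqrt2\zeta,\ 1)^t$. The Cygan distance is $\rho_0((\zeta_1,v_1),(\zeta_2,v_2))=\bigl||\zeta_1-\zeta_2|^2-iv_1+iv_2-2i\Im(\zeta_1\bar\zeta_2)\bigr|^{1/2}$,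 equivalently $\rho_0(z_1,z_2)=|\langle\mathbf{z}_1,\mathbf{z}_2\rangle|^{1/2}$ for standard lifts $\mathbf{z}_1,\mathbf{z}_2$. The Cartan angular invariant of distinct points $z_1,z_2,z_3\in\partial\mathbf{H}^2_{\mathbb{C}}$ with standard lifts $\mathbf z_1,\mathbf z_2,\mathbf z_3$ is $\mathbb{A}(z_1,z_2,z_3)=\arg\bigl(-\langle\mathbf{z}_1,\mathbf{z}_2\rangle\langle\mathbf{z}_2,\mathbf{z}_3\rangle\langle\mathbf{z}_3,\mathbf{z}_1\rangle\bigr)\in[-\pi/2,\pi/2]$. An $\mathbb{R}$-circle is the boundary in $\partial\mathbf{H}^2_{\mathbb{C}}$ of a totally geodesic Lagrangian plane in $\mathbf{H}^2_{\mathbb{C}}$ (the intersection of $\mathbf{H}^2_{\mathbb{C}}$ with a copy of $\mathbb{RP}^2$ in $\mathbb{CP}^2$); it is the fixed point set in $\partial\mathbf{H}^2_{\mathbb{C}}$ of a unique anti-holomorphic isometric involution $\iota_R$ of $\mathbf{H}^2_{\mathbb{C}}$. It is called finite if it does not contain $\infty$. *)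

(* Defs.v *)
From HB Require Import structures.
From mathcomp Require Import all_boot all_order all_algebra.
From mathcomp Require Import complex.
From mathcomp Require Import all_classical all_reals all_analysis.

Set Implicit Arguments.
Unset Strict Implicit.
Unset Printing Implicit Defensive.

Import Order.TTheory GRing.Theory Num.Theory.
Import numFieldNormedType.Exports.

Local Open Scope classical_set_scope.
Local Open Scope ring_scope.
Local Open Scope complex_scope.

(* Points of CP^2 are the one-dimensional subspaces <[z]>%VS of C^3. *)
Notation CP2 K := {vspace 'cV[K[i]]_3}.

Section ComplexHyperbolicPlane.
Variable K : realType.
Implicit Types (z w : 'cV[K[i]]_3) (p : CP2 K) (L R : set (CP2 K)).

Definition vec3 (F : Type) (a b c : F) : 'cV[F]_3 :=
  \col_(i < 3) nth a [:: a; b; c] i.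

Definition herm z w : K[i] :=
  (w 2%:R 0)^* * z 0 0 + (w 1 0)^* * z 1 0 + (w 0 0)^* * z 2%:R 0.

(* [herm z z] is always real, and the order of K[i] compares a number with 0
   only when it is real. *)
Definition negative z := herm z z < 0.
Definition null z := z != 0 /\ herm z z = 0.

Definition H2C : set (CP2 K) := [set <[z]>%VS | z in [set z | negative z]].
Definition bdH2C : set (CP2 K) := [set <[z]>%VS | z in [set z | null z]].

Definition q_infty : 'cV[K[i]]_3 := vec3 1 0 0.
Definition pt_infty : CP2 K := <[q_infty]>%VS.

Definition heisenberg : Type := (K[i] * K)%type.

Definition std_lift (h : heisenberg) : 'cV[K[i]]_3 :=
  vec3 (- `|h.1| ^+ 2 + 'i * h.2%:C) ((Num.sqrt 2)%:C * h.1) 1.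

Definition heis_pt (h : heisenberg) : CP2 K := <[std_lift h]>%VS.

(* The norm of K[i] takes (nonnegative real) values in K[i], hence the [Re]. *)
Definition cygan (h1 h2 : heisenberg) : K :=
  let: (zeta1, v1) := h1 in
  let: (zeta2, v2) := h2 in
  Num.sqrt (complex.Re
    `| `|zeta1 - zeta2| ^+ 2 - 'i * v1%:C + 'i * v2%:C
       - 2 * 'i * (complex.Im (zeta1 * zeta2^*))%:C |).

(* Principal argument, with values in ]-pi, pi]; the value at 0 is junk. *)
Definition carg (x : K[i]) : K :=
  let t := acos (complex.Re x / complex.Re `|x|) in
  if 0 <= complex.Im x then t else - t.

Definition cartan z1 z2 z3 : K :=
  carg (- (herm z1 z2 * herm z2 z3 * herm z3 z1)).

(* [B] in GL(3,C) gives the copy B(RP^2) of RP^2 in CP^2. It meets H2C in a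
   totally geodesic Lagrangian plane exactly when the imaginary part of the
   Hermitian form, i.e. the symplectic form, vanishes on the real span of the
   columns of [B]. *)
Definition lagrangian_plane L :=
  exists B : 'M[K[i]]_3,
    [/\ B \in unitmx,
        forall x y : 'cV[K]_3,
          complex.Im (herm (B *m map_mx (real_complex K) x)
                           (B *m map_mx (real_complex K) y)) = 0 &
        L = H2C `&` [set <[B *m map_mx (real_complex K) x]>%VS
                    | x in [set x : 'cV[K]_3 | x != 0]]].

(* The points of bdH2C in the closure of [L] in CP^2: a line <[z]> is a limit of
   lines of [L] iff [z] is a limit of vectors spanning lines of [L]. *)
Definition ideal_boundary L : set (CP2 K) :=
  [set <[z]>%VS | z in [set z | null z /\
    forall eps : K, 0 < eps ->
      exists2 w, L <[w]>%VS & forall i, `|w i 0 - z i 0| < eps%:C]].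

Definition R_circle R :=
  exists2 L, lagrangian_plane L & R = ideal_boundary L.

Definition finite_R_circle R := R_circle R /\ ~ R pt_infty.

Definition in_U21 (A : 'M[K[i]]_3) :=
  forall z w, herm (A *m z) (A *m w) = herm z w.

(* The anti-holomorphic isometries of H2C are the elements of PU(2,1) composed
   with complex conjugation of the coordinates. They act on H2C and on its
   boundary; [f] is unconstrained elsewhere. *)
Definition antiholomorphic_isometry (f : CP2 K -> CP2 K) :=
  exists2 A : 'M[K[i]]_3, in_U21 A &
    forall z, negative z \/ null z ->
      f <[z]>%VS = <[A *m map_mx (@conjc K) z]>%VS.

Definition antiholomorphic_involution (f : CP2 K -> CP2 K) :=
  antiholomorphic_isometry f /\
  forall p, (H2C `|` bdH2C) p -> f (f p) = p.

Definition boundary_fixed_points (f : CP2 K -> CP2 K) : set (CP2 K) :=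
  [set p | bdH2C p /\ f p = p].

Definition max_cygan_to_others (R : set (CP2 K)) (h : heisenberg) (d : K) :=
  (exists h', [/\ R (heis_pt h'), h' <> h & cygan h h' = d]) /\
  (forall h', R (heis_pt h') -> h' <> h -> cygan h h' <= d).

End ComplexHyperbolicPlane.

(* Main.v *)
(** Write P = <p, o> for the standard lifts of a point p of R and of
    o = iota(oo). Since iota exchanges oo and o, |P| = r^2 on R, and for two
    points <p, h> = P + conj Q + 2 (zeta_p - zeta_o) conj(zeta_h - zeta_o), where
    |zeta_p - zeta_o|^2 = - Re P; the Cartan invariant is arg(- P). With
    P = i r^2 exp(2 i alpha) and Q = i r^2 exp(2 i beta), the triangle
    inequality bounds |<p, h>| by
    2 r^2 (sqrt(sin alpha cos beta) + sqrt(cos alpha sin beta))^2,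
    and Hoelder's inequality with exponents 4/3 and 4 maximises this over beta.
    The point of R attaining the maximum is built from p by multiplying its
    component orthogonal to the lifts of oo and o by a suitable complex number. *)
Require Import Defs.
From HB Require Import structures.
From mathcomp Require Import all_boot all_order all_algebra.
From mathcomp Require Import complex ring lra.
From mathcomp Require Import all_classical all_reals all_analysis.

Import Order.TTheory GRing.Theory Num.Theory.
Import numFieldNormedType.Exports.

Local Open Scope classical_set_scope.
Local Open Scope ring_scope.
Local Notation normc := ComplexField.Normc.normc.

(** * The Hölder inequality behind the maximisation over beta *)

(** Cauchy-Schwarz is applied twice, through the intermediate sum [S]; by Lagrange's identity each
    defect is a square. *)
Lemma holder43 (K : realType) (P Q x y : K) :
  (Q ^+ 3 * x + P ^+ 3 * y) ^+ 4 <= (P ^+ 4 + Q ^+ 4) ^+ 3 * (x ^+ 4 + y ^+ 4).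
Proof.
pose S := Q ^+ 2 * x ^+ 2 + P ^+ 2 * y ^+ 2.
have S0 : 0 <= S by rewrite addr_ge0// mulr_ge0// sqr_ge0.
have M0 : 0 <= P ^+ 4 + Q ^+ 4 by rewrite addr_ge0// exprn_even_ge0.
have h1 : (Q ^+ 3 * x + P ^+ 3 * y) ^+ 2 <= (P ^+ 4 + Q ^+ 4) * S.
  rewrite -subr_ge0 (_ : _ - _ = (Q ^+ 2 * P * y - P ^+ 2 * Q * x) ^+ 2) ?sqr_ge0//.
  by rewrite /S; ring.
have h2 : S ^+ 2 <= (P ^+ 4 + Q ^+ 4) * (x ^+ 4 + y ^+ 4).
  rewrite -subr_ge0 (_ : _ - _ = (Q ^+ 2 * y ^+ 2 - P ^+ 2 * x ^+ 2) ^+ 2) ?sqr_ge0//.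
  by rewrite /S; ring.
rewrite (_ : 4%N = (2 * 2)%N)// exprM.
apply: (le_trans (lerXn2r 2 _ _ h1)); rewrite ?nnegrE ?sqr_ge0 ?mulr_ge0//.
rewrite exprMn (exprSr _ 2) -mulrA; apply: ler_wpM2l; first exact: sqr_ge0.
exact: h2.
Qed.

(** * Standard lifts, the Hermitian form and the Cygan distance *)

Lemma vec3_eta (F : Type) (z : 'cV[F]_3) : z = vec3 (z 0 0) (z 1 0) (z 2%:R 0).
Proof.
apply/colP => i; rewrite !mxE.
by case: i => [[|[|[|//]]] lti] /=; congr (z _ _); exact/val_inj.
Qed.

Lemma herm_vec3 (K : realType) (a b c a' b' c' : K[i]) :
  herm (vec3 a b c) (vec3 a' b' c') = c'^* * a + b'^* * b + a'^* * c.
Proof. by rewrite /herm !mxE. Qed.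

Lemma std_liftE (K : realType) (a b v : K) :
  std_lift (a +i* b, v)%C = vec3 ((- (a ^+ 2 + b ^+ 2)) +i* v)%C
    ((Num.sqrt 2 * a) +i* (Num.sqrt 2 * b))%C 1.
Proof.
rewrite /std_lift /= -add_Re2_Im2 /=; congr vec3.
  rewrite -complexiE.
  by apply/eqP; rewrite eq_complex /=; apply/andP; split; apply/eqP; ring.
by apply/eqP; rewrite eq_complex /=; apply/andP; split; apply/eqP; ring.
Qed.

Lemma herm_std (K : realType) (a b v a' b' v' : K) :
  herm (std_lift (a +i* b, v)%C) (std_lift (a' +i* b', v')%C) =
  ((- ((a - a') ^+ 2 + (b - b') ^+ 2)) +i* (v - v' + 2 * (b * a' - a * b')))%C.
Proof.
have s2 : Num.sqrt 2 * Num.sqrt 2 = 2 :> K by rewrite -expr2 sqr_sqrtr ?ler0n.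
rewrite !std_liftE herm_vec3 rmorph1 mul1r mulr1.
apply/eqP; rewrite eq_complex /=; apply/andP; split; apply/eqP; ring: s2.
Qed.

Lemma cyganE (K : realType) (h1 h2 : heisenberg K) :
  cygan h1 h2 = Num.sqrt (normc (herm (std_lift h1) (std_lift h2))).
Proof.
case: h1 h2 => [[a b] v] [[a' b'] v']; rewrite herm_std /cygan -complexiE.
rewrite (normc_def (_ - _)) normc_def -rmorphXn sqr_sqrtr /=; last first.
  by rewrite addr_ge0 ?sqr_ge0.
congr (Num.sqrt (Num.sqrt _)).
ring.
Qed.

Lemma vline_eq_scale (F : fieldType) (V : vectType F) (z w : V) :
  <[z]>%VS = <[w]>%VS -> exists k, z = k *: w.
Proof. by move=> zw; apply/vlineP; rewrite -zw memv_line. Qed.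

Lemma vline_scale (F : fieldType) (V : vectType F) (k : F) (z : V) :
  k != 0 -> <[k *: z]>%VS = <[z]>%VS.
Proof.
move=> k0; apply/vspaceP => v; apply/vlineP/vlineP => -[l ->].
  by exists (l * k); rewrite scalerA.
by exists (l / k); rewrite scalerA mulfVK.
Qed.

Lemma herm_scale (K : realType) (k l : K[i]) (z w : 'cV[K[i]]_3) :
  herm (k *: z) (l *: w) = k * l^* * herm z w.
Proof.
rewrite /herm !mxE !rmorphM /=.
move: (_^* ) (_^* ) (_^* ) (_^* ) => l' a b c.
by ring.
Qed.

Lemma herm_q_infty (K : realType) (z : 'cV[K[i]]_3) : herm z (q_infty K) = z 2%:R 0.
Proof. by rewrite /herm !mxE /= rmorph0 rmorph1 !mul0r !add0r mul1r. Qed.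

Lemma herm_conj (K : realType) (z w : 'cV[K[i]]_3) : (herm z w)^* = herm w z.
Proof.
rewrite /herm !rmorphD !rmorphM /= !conjCK.
by move: (_^* ) (_^* ) (_^* ) => *; ring.
Qed.

Lemma std_lift2 (K : realType) (h : heisenberg K) : std_lift h 2%:R 0 = 1.
Proof. by rewrite mxE. Qed.

Lemma null_q_infty (K : realType) : null (q_infty K).
Proof.
split; last by rewrite herm_q_infty mxE.
by apply/eqP => /matrixP/(_ 0 0)/eqP; rewrite !mxE /= oner_eq0.
Qed.

Lemma null_std_lift (K : realType) (h : heisenberg K) : null (std_lift h).
Proof.
split.
  by apply/eqP => /matrixP/(_ 2%:R 0)/eqP; rewrite std_lift2 mxE oner_eq0.
case: h => -[a b] v; rewrite herm_std.
by apply/eqP; rewrite eq_complex /=; apply/andP; split; apply/eqP; ring.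
Qed.

(** Nullity fixes only the real part of the first coordinate; its imaginary part is the free
    vertical coordinate. *)
Lemma null_std1 (K : realType) (w : 'cV[K[i]]_3) :
  herm w w = 0 -> w 2%:R 0 = 1 -> exists h, w = std_lift h.
Proof.
move=> wn w2.
have s2 : Num.sqrt 2 * Num.sqrt 2 = 2 :> K by rewrite -expr2 sqr_sqrtr ?ler0n.
have s0 : Num.sqrt 2 != 0 :> K by rewrite sqrtr_eq0 -ltNge ltr0n.
have wE := vec3_eta _ w; rewrite w2 in wE.
move: (w 0 0) (w 1 0) wE wn => [a v] [x y] {w w2}-> wn.
have wn' : a = - ((x ^+ 2 + y ^+ 2) / 2).
  move: wn; rewrite herm_vec3 => /(congr1 (@complex.Re K)) /=.
  rewrite !(oppr0, mul0r, mul1r, mulr1, mulr0, subr0, addr0) => h; lra.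
exists ((x / Num.sqrt 2) +i* (y / Num.sqrt 2), v)%C.
rewrite std_liftE; congr vec3; apply/eqP; rewrite eq_complex /= ?eqxx ?andbT.
  by rewrite wn' !exprMn !exprVn (expr2 (Num.sqrt 2)) s2 -mulrDl.
by rewrite !(mulrC (Num.sqrt 2)) !mulfVK// !eqxx.
Qed.

Lemma null_std (K : realType) (z : 'cV[K[i]]_3) :
  null z -> z 2%:R 0 != 0 -> exists h, z = z 2%:R 0 *: std_lift h.
Proof.
case=> _ nz c0.
have [|| h hE] := @null_std1 K ((z 2%:R 0)^-1 *: z).
- by rewrite herm_scale nz mulr0.
- by rewrite mxE mulVf.
by exists h; rewrite -hE scalerA mulfV// scale1r.
Qed.

(** * The antiholomorphic involution and its centre *)

Definition conj_act {K : realType} (A : 'M[K[i]]_3) (z : 'cV[K[i]]_3) :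
  'cV[K[i]]_3 := A *m map_mx (@conjc K) z.

Lemma conj_actD {K : realType} (A : 'M[K[i]]_3) z w :
  conj_act A (z + w) = conj_act A z + conj_act A w.
Proof. by rewrite /conj_act map_mxD mulmxDr. Qed.

Lemma conj_actN {K : realType} (A : 'M[K[i]]_3) z :
  conj_act A (- z) = - conj_act A z.
Proof. by rewrite /conj_act map_mxN mulmxN. Qed.

Lemma conj_actZ {K : realType} (A : 'M[K[i]]_3) k z :
  conj_act A (k *: z) = k^* *: conj_act A z.
Proof. by rewrite /conj_act map_mxZ scalemxAr. Qed.

Lemma herm_conj_act {K : realType} {A : 'M[K[i]]_3} z w :
  in_U21 A -> herm (conj_act A z) (conj_act A w) = (herm z w)^*.
Proof. by move=> U; rewrite /conj_act U /herm !mxE !rmorphD !rmorphM. Qed.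

(** The form is nondegenerate: a vector with zero image would be orthogonal to everything, and
    pairing with basis vectors reads off its coordinates. *)
Lemma null_conj_act {K : realType} {A : 'M[K[i]]_3} {z} :
  in_U21 A -> null z -> null (conj_act A z).
Proof.
move=> U [z0 nz]; split; last by rewrite herm_conj_act// nz rmorph0.
apply: contra_neq z0 => sz0.
have zw w : herm z w = 0.
  by rewrite -[herm z w]conjCK -(herm_conj_act _ _ U) sz0 -(scale0r 0)
             -[conj_act A w]scale1r herm_scale !mul0r rmorph0.
rewrite (vec3_eta _ z).
move: (zw (vec3 1 0 0)) (zw (vec3 0 1 0)) (zw (vec3 0 0 1)).
rewrite {1 2 3}/herm !mxE /= !rmorph0 !rmorph1 !mul0r !mul1r !(add0r, addr0).
move=> -> -> ->; apply/colP => i; rewrite !mxE.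
by case: i => [[|[|[|//]]] lti].
Qed.

(* In the coordinates [std_lift h = P q_infty + std_lift o + e], with
   [P = herm (std_lift h) (std_lift o)] and [e] orthogonal to [q_infty] and to
   [std_lift o], the involution exchanges the lines of [q_infty] and
   [std_lift o] and multiplies [e] by a unit. *)
Definition transverse {K : realType} (o h : heisenberg K) : 'cV[K[i]]_3 :=
  std_lift h - herm (std_lift h) (std_lift o) *: q_infty K - std_lift o.

(** Collects all that is used of the involution later: its centre [o], the squared radius [|c|^-1],
    and a membership criterion for [R] in terms of transverse components. *)
Lemma iota_center (K : realType) (R : set (CP2 K)) (iota : CP2 K -> CP2 K) :
  finite_R_circle R -> antiholomorphic_involution iota ->
  boundary_fixed_points iota = R ->
  exists (o : heisenberg K) (c : K[i]),
    [/\ c != 0, iota (pt_infty K) = heis_pt o,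
        forall h, R (heis_pt h) -> `|herm (std_lift h) (std_lift o)| = `|c|^-1 &
        forall p h tau, R (heis_pt p) ->
          `|herm (std_lift h) (std_lift o)| = `|c|^-1 ->
          transverse o h = tau *: transverse o p ->
          (tau^* * (herm (std_lift p) (std_lift o))^*) *: transverse o p =
          (tau * (herm (std_lift h) (std_lift o))^*) *: transverse o p ->
          R (heis_pt h)].
Proof.
move=> [_ Rinf] [[A A_isom iotaE] iotaK] RE.
pose s := conj_act A; pose q := q_infty K.
have nq : null q := null_q_infty K.
have iota_null z : null z -> iota <[z]>%VS = <[s z]>%VS.
  by move=> nz; apply: iotaE; right.
have nullP (h : heisenberg K) : bdH2C (heis_pt h).
  by exists (std_lift h) => //; exact: null_std_lift.
pose c := s q 2%:R 0.
have nsq : null (s q) := null_conj_act A_isom nq.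
(* If [c = 0], nullity makes [s q] a multiple of [q], so infinity is fixed and lies on [R], against
   finiteness. *)
have c0 : c != 0.
  apply/eqP => c0; apply: Rinf; rewrite -RE; split; first by exists q.
  rewrite iota_null//; have [sq0 sqn] := nsq.
  have sqE := vec3_eta _ (s q); rewrite -/c c0 in sqE.
  have b0 : s q 1 0 = 0.
    move: sqn; rewrite sqE herm_vec3 rmorph0 mul0r mulr0 addr0 add0r => /eqP.
    by rewrite mulf_eq0 conjC_eq0 orbb !mxE /= => /eqP.
  rewrite b0 in sqE.
  have sqq : s q = s q 0 0 *: q.
    rewrite {1}sqE; apply/colP => i; rewrite !mxE.
    by case: i => [[|[|[|//]]] lti] /=; rewrite ?mulr0// mulr1.
  rewrite sqq vline_scale//; apply: contra_neq sq0 => a0.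
  by rewrite sqq a0 scale0r.
case: (null_std _ _ nsq c0) => o oE; rewrite -/c in oE.
have hq h : herm (std_lift h) q = 1 by rewrite herm_q_infty std_lift2.
(* Involutivity on lines gives this up to a scalar [l]; pairing with [s q] forces [l = 1]. *)
have ssq : s (s q) = q.
  have : <[s (s q)]>%VS = <[q]>%VS.
    rewrite -iota_null// -iota_null// iotaK//; right; exact: (imageP _ nq).
  case/vline_eq_scale => l lE.
  have l1 : l * c^* = c^*.
    have := herm_conj_act (s q) q A_isom; rewrite -/s lE -[s q]scale1r.
    rewrite herm_scale rmorph1 mulr1 scale1r herm_q_infty -/c.
    by rewrite -(herm_conj _ (s q)) herm_q_infty.
  rewrite lE -[RHS]scale1r; congr (_ *: _); apply/eqP.
  by rewrite -(inj_eq (mulIf (_ : c^* != 0))) ?conjC_eq0// mul1r l1.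
have so : s (std_lift o) = (c^-1)^* *: q.
  rewrite -[std_lift o]scale1r -(mulVf c0) -scalerA -oE.
  by have := conj_actZ A c^-1 (s q); rewrite -/s ssq.
have hoE z : herm z (s q) = c^* * herm z (std_lift o).
  by rewrite oE -[z]scale1r herm_scale mul1r scale1r.
(* A fixed line has [s (std_lift h) = m *: std_lift h]; pairing with [s (s q) = q] gives [m], and
   pairing with [s q] then gives the modulus. *)
have fixP h : R (heis_pt h) ->
    s (std_lift h) = (c * (herm (std_lift h) (std_lift o))^*) *: std_lift h /\
    `|herm (std_lift h) (std_lift o)| = `|c|^-1.
  rewrite -RE => -[_]; rewrite iota_null; last exact: null_std_lift.
  case/vline_eq_scale => m mE.
  have := herm_conj_act (std_lift h) (s q) A_isom.
  rewrite -/s mE ssq -[q]scale1r herm_scale rmorph1 mulr1 scale1r hq mulr1 hoE.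
  rewrite rmorphM /= conjCK => m1; split; first by rewrite m1.
  have := herm_conj_act (std_lift h) q A_isom.
  rewrite -/s mE -[s q]scale1r herm_scale rmorph1 mulr1 hoE hq rmorph1 m1.
  move/(congr1 Num.norm); rewrite !normrM !norm_conjC normr1.
  rewrite -expr2 => /eqP; rewrite pexpr_eq1 ?mulr_ge0// => /eqP cP.
  by apply: (mulfI (_ : `|c| != 0)); rewrite ?mulfV ?normr_eq0.
exists o, c; split => //.
- rewrite iota_null// oE vline_scale//.
- by move=> h /fixP[].
move=> p h tau Rp he hE eE.
have [sp np] := fixP _ Rp.
pose P := herm (std_lift p) (std_lift o); pose Q := herm (std_lift h) (std_lift o).
have NP x : `|x| = `|c|^-1 -> c * x^* * x = (c^-1)^*.
  move=> xE; apply: (mulIf (_ : c^* != 0)); rewrite ?conjC_eq0//.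
  rewrite -rmorphM mulVf// rmorph1 -(mulrA c) (mulrC x^* ) -normCK xE mulrAC -normCK.
  by rewrite -exprMn mulfV ?expr1n// normr_eq0.
have dec x : std_lift x =
    herm (std_lift x) (std_lift o) *: q + std_lift o + transverse o x.
  by rewrite /transverse -/q addrC -[_ - _ - _]addrA -opprD subrK.
have se : s (transverse o p) = (c * P^*) *: transverse o p.
  rewrite /s !conj_actD !conj_actN conj_actZ -/s sp -/P -/q so oE.
  rewrite /transverse -/P -/q !scalerDr !scalerN !scalerA (NP _ np).
  rewrite (mulrC c) [LHS]addrAC.
  reflexivity.
rewrite -RE; split=> //; rewrite iota_null; last exact: null_std_lift.
(* The [q] components agree by [NP], the [std_lift o] components directly, the transverse ones by
   [eE]. *)
suff -> : s (std_lift h) = (c * Q^*) *: std_lift h.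
  by rewrite vline_scale// mulf_neq0// conjC_eq0 -normr_eq0 he invr_eq0 normr_eq0.
rewrite -/P -/Q in eE.
rewrite (dec h) -/Q hE; move: (transverse o p) se eE {hE} => e se eE.
rewrite /s !conj_actD !conj_actZ -/s so oE se !scalerDr !scalerA (NP _ he).
rewrite [in RHS](addrC ((c^-1)^* *: q)) (mulrC Q^* ) mulrCA.
rewrite -(scalerA c (tau^* * P^* )) eE scalerA.
rewrite [in LHS](mulrC tau) mulrA.
reflexivity.
Qed.

(** * Polar form and coordinates around the centre *)

Lemma carg_polar (K : realType) (x : K[i]) : x != 0 ->
  x = ((normc x * cos (carg x)) +i* (normc x * sin (carg x)))%C.
Proof.
case: x => a b x0.
have N0 : 0 < Num.sqrt (a ^+ 2 + b ^+ 2).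
  rewrite sqrtr_gt0 lt0r paddr_eq0 ?sqr_ge0// !sqrf_eq0 addr_ge0 ?sqr_ge0// andbT.
  by move: x0; rewrite eq_complex.
have Ne := lt0r_neq0 N0.
have N2 : Num.sqrt (a ^+ 2 + b ^+ 2) ^+ 2 = a ^+ 2 + b ^+ 2.
  by rewrite sqr_sqrtr// addr_ge0 ?sqr_ge0.
rewrite /carg normc_def /=; set N := Num.sqrt _ in N0 Ne N2 *.
have aN : -1 <= a / N <= 1.
  rewrite -ler_norml normrM normfV (gtr0_norm N0) ler_pdivrMr// mul1r.
  by rewrite -(ler_sqr (normr_ge0 _) (ltW N0)) real_normK ?num_real// N2 lerDl sqr_ge0.
have sE : sin (acos (a / N)) = `|b| / N.
  have bN : 0 <= `|b| / N by rewrite divr_ge0// ltW.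
  rewrite sin_acos// -[RHS](ger0_norm bN) -sqrtr_sqr; congr Num.sqrt.
  rewrite !exprMn !exprVn real_normK ?num_real//.
  apply: (mulIf (_ : N ^+ 2 != 0)); first by rewrite sqrf_eq0.
  by rewrite mulrBl !divfK ?sqrf_eq0// mul1r N2 addrAC subrr add0r.
apply/eqP; rewrite eq_complex /= -/N.
case: ifPn => b0; rewrite ?cosN ?sinN acosK ?in_itv//= sE;
  rewrite !(mulrC N) ?mulNr !divfK// eqxx /=.
  by rewrite ger0_norm.
by rewrite ltr0_norm ?opprK// ltNge.
Qed.

(** Since [q_infty] and [std_lift o] are null with mutual product 1, three terms survive; the last
    is the product of the transverse components. *)
Lemma herm_split (K : realType) (o p h : heisenberg K) :
  herm (std_lift p) (std_lift h) = herm (std_lift p) (std_lift o) +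
    (herm (std_lift h) (std_lift o))^* + 2 * ((p.1 - o.1) * (h.1 - o.1)^*).
Proof.
case: o p h => [[a b] v] [[a1 b1] v1] [[a2 b2] v2]; rewrite !herm_std /=.
by apply/eqP; rewrite eq_complex /=; apply/andP; split; apply/eqP; ring.
Qed.

Lemma Re_herm_std (K : realType) (o h : heisenberg K) :
  complex.Re (herm (std_lift h) (std_lift o)) = - normc (h.1 - o.1) ^+ 2.
Proof.
case: o h => [[a b] v] [[a1 b1] v1]; rewrite herm_std /=.
by rewrite sqr_sqrtr// addr_ge0 ?sqr_ge0.
Qed.

Lemma transverseE (K : realType) (o h : heisenberg K) :
  transverse o h =
  vec3 (- 2 * ((h.1 - o.1) * o.1^*)) ((Num.sqrt 2)%:C%C * (h.1 - o.1)) 0.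
Proof.
case: o h => [[a b] v] [[a1 b1] v1].
rewrite /transverse herm_std !std_liftE; apply/colP => i; rewrite !mxE /=.
case: i => [[|[|[|//]]] lti] /=; last by ring.
  by apply/eqP; rewrite eq_complex /=; apply/andP; split; apply/eqP; ring.
by apply/eqP; rewrite eq_complex /=; apply/andP; split; apply/eqP; ring.
Qed.

(** [tau] dictates the horizontal coordinate, which forces the real part of the product; the
    vertical coordinate stays free to match the imaginary part of [P]. *)
Lemma exists_transverse (K : realType) (o p : heisenberg K) (tau P : K[i]) :
  complex.Re P = - normc (tau * (p.1 - o.1)) ^+ 2 ->
  exists h : heisenberg K,
    [/\ h.1 - o.1 = tau * (p.1 - o.1),
        herm (std_lift h) (std_lift o) = P &
        transverse o h = tau *: transverse o p].
Proof.
move=> PE; pose z := o.1 + tau * (p.1 - o.1).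
pose v := complex.Im P + o.2 - 2 * complex.Im (z * o.1^*).
have zo : z - o.1 = tau * (p.1 - o.1) by rewrite /z addrAC subrr add0r.
exists (z, v); split=> //; last first.
  rewrite !transverseE /= zo; apply/colP => i; rewrite !mxE.
  by case: i => [[|[|[|//]]] lti] /=; ring.
have := Re_herm_std _ o (z, v); rewrite /= zo -PE.
rewrite /v; case: (o) (z) => [[a b] w] [x y]; rewrite herm_std /= => rE.
by case: P {PE v} rE => r s /= <-; apply/eqP; rewrite eq_complex /= eqxx; apply/eqP; ring.
Qed.

Lemma normc_ge0 (K : realType) (z : K[i]) : 0 <= normc z.
Proof. by case: z => a b; exact: sqrtr_ge0. Qed.

Lemma normc_conj (K : realType) (z : K[i]) : normc z^* = normc z.
Proof. by case: z => a b /=; rewrite sqrrN. Qed.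

Lemma normcD (K : realType) (x y : K[i]) : normc (x + y) <= normc x + normc y.
Proof. exact: (@le_normcD K x y). Qed.

(** * The upper bound on the distance *)

(** Half-angle formulas: [a] and [b] are the sine and cosine of an angle, [x ^+ 2] and [y ^+ 2]
    those of its half. The further square roots [x] and [y] are what [holder43] takes. *)
Lemma unit_half_angle (K : realType) (a b : K) : 0 <= a -> a ^+ 2 + b ^+ 2 = 1 ->
  exists x y, [/\ 0 <= x, 0 <= y, x ^+ 4 + y ^+ 4 = 1,
    a = 2 * x ^+ 2 * y ^+ 2 & b = y ^+ 4 - x ^+ 4].
Proof.
move=> a0 ab.
have sq4 (t : K) : 0 <= t -> Num.sqrt (Num.sqrt t) ^+ 4 = t.
  by move=> t0; rewrite -[4%N]/(2 * 2)%N exprM !sqr_sqrtr ?sqrtr_ge0.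
have b1 : 0 <= (1 + b) / 2 by nra.
have b2 : 0 <= (1 - b) / 2 by nra.
exists (Num.sqrt (Num.sqrt ((1 - b) / 2))), (Num.sqrt (Num.sqrt ((1 + b) / 2))).
rewrite !sq4// !sqrtr_ge0; split=> //; try lra.
rewrite !sqr_sqrtr ?sqrtr_ge0// -mulrA -sqrtrM//.
rewrite (_ : (1 - b) / 2 * ((1 + b) / 2) = (a / 2) ^+ 2); last first.
  by rewrite exprMn (_ : a ^+ 2 = 1 - b ^+ 2); [field | rewrite -ab addrK].
rewrite sqrtr_sqr ger0_norm; lra.
Qed.

(* [P ^+ 6] and [Q ^+ 6] are the cosine and the sine of the angle alpha of [p];
   in the proof, [x ^+ 4] and [y ^+ 4] are those of the angle beta of [h]. *)
Lemma herm_upper (K : realType) (o p h : heisenberg K) (rho P Q m : K) :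
  0 < rho -> 0 <= P -> 0 <= Q -> 0 <= m ->
  P ^+ 12 + Q ^+ 12 = 1 -> m ^+ 4 = P ^+ 4 + Q ^+ 4 ->
  herm (std_lift p) (std_lift o) =
    ((- (rho * (2 * P ^+ 6 * Q ^+ 6))) +i* (rho * (P ^+ 12 - Q ^+ 12)))%C ->
  normc (herm (std_lift h) (std_lift o)) = rho ->
  normc (herm (std_lift p) (std_lift h)) <= 2 * rho * m ^+ 6.
Proof.
move=> r0 P0 Q0 m0 PQ mE pE hE.
have := Re_herm_std _ o h; have := Re_herm_std _ o p.
rewrite (herm_split _ o p h) pE.
move: hE; case: (herm (std_lift h) _) => a b hE dp dh.
rewrite /= in hE dp dh.
have r2 : a ^+ 2 + b ^+ 2 = rho ^+ 2.
  by rewrite -hE sqr_sqrtr// addr_ge0 ?sqr_ge0.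
have a0 : a <= 0 by rewrite dh oppr_le0 sqr_ge0.
(* With both signs changed, [x ^+ 2] is the cosine and [y ^+ 2] the sine of beta. *)
have [|| x [y [x0 y0 xy aE bE]]] := @unit_half_angle K (- a / rho) (- b / rho).
- by rewrite divr_ge0 ?oppr_ge0// ltW.
- by rewrite !exprMn !sqrrN -mulrDl r2 -exprMn mulfV ?expr1n ?gt_eqF.
have aE' : a = - (rho * (2 * x ^+ 2 * y ^+ 2)).
  by rewrite -aE; field; rewrite gt_eqF.
have bE' : b = - (rho * (y ^+ 4 - x ^+ 4)).
  by rewrite -bE; field; rewrite gt_eqF.
set dP := normc (p.1 - o.1) in dp *; set dH := normc (h.1 - o.1) in dh *.
have dP0 : 0 <= dP := normc_ge0 _ _.
have dH0 : 0 <= dH := normc_ge0 _ _.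
have dPH : dP * dH = rho * (2 * P ^+ 3 * Q ^+ 3 * x * y).
  apply/eqP; rewrite -(eqrXn2 (_ : 0 < 2)%N) ?mulr_ge0 ?exprn_ge0 ?(ltW r0)//.
  rewrite exprMn -[dP ^+ 2]opprK -dp -[dH ^+ 2]opprK -dh aE'; apply/eqP; ring.
apply: (@le_trans _ _ (2 * rho * (Q ^+ 3 * x + P ^+ 3 * y) ^+ 2)); last first.
  rewrite ler_pM2l ?mulr_gt0//.
  rewrite -(ler_pXn2r (_ : 0 < 2)%N) ?nnegrE ?sqr_ge0 ?exprn_ge0//.
  rewrite -!exprM -[(6 * 2)%N]/(4 * 3)%N (exprM m) mE.
  by have := holder43 _ P Q x y; rewrite xy mulr1.
apply: (le_trans (normcD _ _ _)).
have -> : normc (2 * ((p.1 - o.1) * (h.1 - o.1)^*)) = 2 * (dP * dH).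
  rewrite !ComplexField.Normc.normcM; congr (_ * (_ * _)).
    by rewrite /= addr0 expr0n addr0 sqrtr_sqr ger0_norm.
  exact: normc_conj.
(* This modulus is [2 * rho * sin (alpha + beta)], expanded. *)
have -> : normc ((- (rho * (2 * P ^+ 6 * Q ^+ 6)) +i* (rho * (P ^+ 12 - Q ^+ 12)))%C
     + (a +i* b)%C^*) = 2 * rho * (Q ^+ 6 * x ^+ 2 + P ^+ 6 * y ^+ 2).
  have n0 : 0 <= 2 * rho * (Q ^+ 6 * x ^+ 2 + P ^+ 6 * y ^+ 2).
    by rewrite mulr_ge0 ?addr_ge0 ?mulr_ge0 ?exprn_ge0// ltW.
  rewrite -[RHS](ger0_norm n0) -sqrtr_sqr /= aE' bE'; congr Num.sqrt.
  have P12 : P ^+ 12 = 1 - Q ^+ 12 by rewrite -PQ addrK.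
  have x4 : x ^+ 4 = 1 - y ^+ 4 by rewrite -xy addrK.
  ring: P12 x4.
(* The cross term from [dPH] completes the square exactly. *)
rewrite dPH le_eqVlt; apply/orP; left; apply/eqP; ring.
Qed.

(** * A point of the R-circle attaining the bound *)

Lemma mul_conj_normc (K : realType) (z : K[i]) : z * z^* = (normc z ^+ 2)%:C%C.
Proof.
case: z => a b; rewrite /= sqr_sqrtr ?addr_ge0 ?sqr_ge0//.
by apply/eqP; rewrite eq_complex /=; apply/andP; split; apply/eqP; ring.
Qed.

(* The angles alpha of [p] and beta of [h] are related by [tan beta = (cot alpha) ^ (1/3)], the equality
   case of Hoelder's inequality; with [W = 1 / (X ^+ 2 + Y ^+ 2)] this is
   [cos beta = Y sqrt W] and [sin beta = X sqrt W]. *)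
Lemma farthest_point (K : realType) (o p : heisenberg K) (rho X Y : K) :
  0 < rho -> X ^+ 6 + Y ^+ 6 = 1 ->
  herm (std_lift p) (std_lift o) =
    ((- (rho * (2 * X ^+ 3 * Y ^+ 3))) +i* (rho * (X ^+ 6 - Y ^+ 6)))%C ->
  exists (h : heisenberg K) (tau : K[i]),
    [/\ normc (herm (std_lift h) (std_lift o)) = rho,
        transverse o h = tau *: transverse o p,
        (tau^* * (herm (std_lift p) (std_lift o))^*) *: transverse o p =
          (tau * (herm (std_lift h) (std_lift o))^*) *: transverse o p &
        normc (herm (std_lift p) (std_lift h)) ^+ 2 =
          4 * rho ^+ 2 * (X ^+ 2 + Y ^+ 2) ^+ 3].
Proof.
move=> r0 XY1 pE.
pose W := X ^+ 4 - X ^+ 2 * Y ^+ 2 + Y ^+ 4.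
have MW : (X ^+ 2 + Y ^+ 2) * W = 1 by rewrite -XY1 /W; ring.
(* A positive multiple of -exp(i (beta - alpha)): this aligns the terms of [herm_split], giving
   equality in the triangle inequality. If [X * Y = 0], division by zero leaves [tau = -1], and
   [p.1 = o.1] then. *)
pose tau := ((- 1) +i* (- ((X ^+ 2 - Y ^+ 2) / (X * Y))))%C.
pose Q := ((- (rho * (2 * X * Y * W))) +i* (- (rho * ((X ^+ 2 - Y ^+ 2) * W))))%C.
have := Re_herm_std _ o p; rewrite pE /= => /eqP.
rewrite eqr_opp eq_sym => /eqP dpE.
have QE : complex.Re Q = - normc (tau * (p.1 - o.1)) ^+ 2.
  rewrite ComplexField.Normc.normcM exprMn dpE /= sqr_sqrtr ?addr_ge0 ?sqr_ge0//.
  have [/eqP|XYn0] := eqVneq (X * Y) 0.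
    by rewrite mulf_eq0 => /orP[]/eqP->; rewrite !(mulr0, mul0r, expr0n, oppr0).
  congr (- _); rewrite /W; field.
  by move: XYn0; rewrite mulf_eq0 negb_or => /andP[-> ->].
have [h [hz hE he]] := @exists_transverse K o p tau Q QE.
exists h, tau; rewrite hE; split=> //.
- have n0 : 0 <= rho := ltW r0.
  rewrite -[RHS](ger0_norm n0) -sqrtr_sqr /=; congr Num.sqrt.
  transitivity (rho ^+ 2 * ((X ^+ 2 + Y ^+ 2) * W) ^+ 2); first by ring.
  by rewrite MW expr1n mulr1.
- have [/eqP|XYn0] := eqVneq (X * Y) 0.
    rewrite mulf_eq0 => XY0; rewrite transverseE.
    have -> : p.1 - o.1 = 0.
      apply: ComplexField.Normc.eq0_normc; apply/eqP; rewrite -sqrf_eq0 dpE.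
      by case/orP: XY0 => /eqP->; rewrite !(mulr0, mul0r, expr0n).
    by apply/colP => i; rewrite !mxE; case: i => [[|[|[|//]]] lti] /=;
      rewrite !(mul0r, mulr0).
  congr (_ *: _); rewrite /tau /Q /W; apply/eqP; rewrite eq_complex /=.
  move: XYn0; rewrite mulf_eq0 negb_or => /andP[Xn0 Yn0].
  by apply/andP; split; apply/eqP; field; rewrite Xn0 Yn0.
- rewrite (herm_split _ o p h) pE hE hz.
  rewrite rmorphM /=.
  have -> : (p.1 - o.1) * (tau^* * (p.1 - o.1)^*) =
      ((rho * (2 * X ^+ 3 * Y ^+ 3)))%:C%C * tau^*.
    rewrite mulrCA mulrC; congr (_ * _).
    by rewrite -dpE mul_conj_normc.
  have tE : (rho * (2 * X ^+ 3 * Y ^+ 3))%:C%C * tau^* =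
      ((- (rho * (2 * X ^+ 3 * Y ^+ 3))) +i*
        (rho * (2 * X ^+ 2 * Y ^+ 2) * (X ^+ 2 - Y ^+ 2)))%C.
    have [/eqP|XYn0] := eqVneq (X * Y) 0.
      by rewrite mulf_eq0 => /orP[]/eqP->; apply/eqP; rewrite eq_complex /=;
        rewrite !(mulr0, mul0r, expr0n, oppr0, subr0, addr0)/= !eqxx.
    move: XYn0; rewrite mulf_eq0 negb_or => /andP[Xn0 Yn0].
    apply/eqP; rewrite eq_complex /=.
    by apply/andP; split; apply/eqP; field; rewrite Xn0 Yn0.
  rewrite tE /Q /= sqr_sqrtr ?addr_ge0 ?sqr_ge0//.
  rewrite /W.
  (* The factor 1, written [(X ^+ 2 + Y ^+ 2) * W], makes both sides homogeneous of degree 12 in [X]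
     and [Y], so that [ring] applies. *)
  transitivity (4 * rho ^+ 2 * (X ^+ 2 + Y ^+ 2) ^+ 3 *
      ((X ^+ 2 + Y ^+ 2) * W)); last by rewrite MW mulr1.
  rewrite /W; ring.
Qed.

(** * Real powers and the final maximum *)

Lemma powR_root_exp (K : realType) (a : K) (n k : nat) :
  0 <= a -> a `^ (k%:R / n%:R) = (a `^ (1 / n%:R)) ^+ k.
Proof. by move=> a0; rewrite -powR_mulrn ?powR_ge0// -powRrM mulrAC mul1r. Qed.

Lemma normr_eq_inv (K : realType) (x c : K[i]) :
  `|x| = `|c|^-1 <-> normc x = (normc c)^-1.
Proof.
have N (z : K[i]) : `|z| = (normc z)%:C%C by case: z.
by rewrite !N -fmorphV; split=> [/complexI|->].
Qed.

Theorem lemma1p6 (K : realType) (R : set (CP2 K)) (iota : CP2 K -> CP2 K)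
    (R_fin : finite_R_circle R)
    (iota_inv : antiholomorphic_involution iota)
    (R_fixed : boundary_fixed_points iota = R) :
  exists (o : heisenberg K) (r : K),
    [/\ iota (pt_infty K) = heis_pt o,
        forall h : heisenberg K, R (heis_pt h) -> cygan o h = r &
        forall (alpha : K) (p : heisenberg K),
          0 <= alpha <= pi / 2 ->
          R (heis_pt p) ->
          cartan (std_lift p) (std_lift o) (q_infty K) = 2 * alpha - pi / 2 ->
          max_cygan_to_others R p
            (2 `^ (1 / 2) * r *
             (cos alpha `^ (2 / 3) + sin alpha `^ (2 / 3)) `^ (3 / 4))].
Proof.
have [ o [c [c0 oE oR inR]]] := @iota_center K R iota R_fin iota_inv R_fixed.
pose rho := (normc c)^-1.
have r0 : 0 < rho.
  rewrite invr_gt0 lt0r; apply/andP; split.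
    by apply: contra_neq c0; exact: ComplexField.Normc.eq0_normc.
  exact: normc_ge0.
have {}oR h : R (heis_pt h) -> normc (herm (std_lift h) (std_lift o)) = rho.
  by move/oR/normr_eq_inv.
exists o, (Num.sqrt rho); split=> // [h Rh|alpha p /andP[al0 al1] Rp pA].
  by rewrite cyganE -(herm_conj _ (std_lift h)) normc_conj oR.
have C0 : 0 <= cos alpha.
  apply: cos_ge0_pihalf.
  by rewrite al1 andbT (le_trans _ al0)// oppr_le0 divr_ge0 ?pi_ge0.
have S0 : 0 <= sin alpha.
  apply: sin_ge0_pi.
  by rewrite al0 (le_trans al1)// ler_pdivrMr// ler_peMr ?pi_ge0// ler1n.
(* Products with [q_infty] are 1, so the Cartan invariant is the argument of minus this product,
   whose modulus is [rho]. *)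
have pE : herm (std_lift p) (std_lift o) =
    ((- (rho * (2 * cos alpha * sin alpha))) +i*
      (rho * (cos alpha ^+ 2 - sin alpha ^+ 2)))%C.
  move: pA; rewrite /cartan herm_q_infty std_lift2 -(herm_conj _ (std_lift p)).
  rewrite herm_q_infty std_lift2 rmorph1 !mulr1 => pA.
  have pr := oR p Rp.
  have p0 : - herm (std_lift p) (std_lift o) != 0.
    rewrite oppr_eq0; apply/eqP => h0; move: r0; rewrite -pr h0.
    by rewrite ComplexField.Normc.normc0 ltxx.
  rewrite -[LHS]opprK (carg_polar _ _ p0) pA normcN pr.
  rewrite cosB sinB cos_pihalf sin_pihalf !mulr0 !mulr1 add0r sub0r.
  rewrite (_ : 2 * alpha = alpha + alpha) ?mulr_natl// cosD sinD.
  by apply/eqP; rewrite eq_complex /=; apply/andP; split; apply/eqP; ring.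
(* Sixth roots turn the exponents 2/3 into fourth powers, leaving polynomial identities. *)
pose P := cos alpha `^ (1 / 6); pose Q := sin alpha `^ (1 / 6).
have PC : P ^+ 6 = cos alpha by rewrite -powR_root_exp// divff// powRr1.
have QS : Q ^+ 6 = sin alpha by rewrite -powR_root_exp// divff// powRr1.
have P12 : P ^+ 12 = cos alpha ^+ 2 by rewrite -PC -exprM.
have Q12 : Q ^+ 12 = sin alpha ^+ 2 by rewrite -QS -exprM.
have P0 : 0 <= P := powR_ge0 _ _.
have Q0 : 0 <= Q := powR_ge0 _ _.
have PQ1 : P ^+ 12 + Q ^+ 12 = 1 by rewrite P12 Q12 cos2Dsin2.
have P4 : cos alpha `^ (2 / 3) = P ^+ 4.
  by rewrite -powR_root_exp//; congr (_ `^ _); field.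
have Q4 : sin alpha `^ (2 / 3) = Q ^+ 4.
  by rewrite -powR_root_exp//; congr (_ `^ _); field.
have M0 : 0 <= P ^+ 4 + Q ^+ 4 by rewrite addr_ge0 ?exprn_ge0.
pose m := (P ^+ 4 + Q ^+ 4) `^ (1 / 4).
have m4 : m ^+ 4 = P ^+ 4 + Q ^+ 4 by rewrite -powR_root_exp// divff// powRr1.
have m0 : 0 < m.
  rewrite lt0r powR_ge0 andbT; apply/eqP => m0.
  move: m4; rewrite m0 expr0n /= => /esym/eqP.
  rewrite paddr_eq0 ?exprn_ge0// !expf_eq0 /= => /andP[/eqP PZ /eqP QZ].
  by move: PQ1; rewrite PZ QZ !expr0n addr0 => /esym/eqP; rewrite oner_eq0.
rewrite P4 Q4 powR_root_exp// -/m div1r powR12_sqrt//.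
set d := _ * _ * _.
have d0 : 0 <= d by rewrite !mulr_ge0 ?sqrtr_ge0 ?exprn_ge0// ltW.
have d2 : d ^+ 2 = 2 * rho * m ^+ 6.
  transitivity (Num.sqrt 2 ^+ 2 * Num.sqrt rho ^+ 2 * m ^+ 6); first by rewrite /d; ring.
  by rewrite !sqr_sqrtr ?(ltW r0).
have pE' : herm (std_lift p) (std_lift o) =
    ((- (rho * (2 * P ^+ 6 * Q ^+ 6))) +i* (rho * (P ^+ 12 - Q ^+ 12)))%C.
  by rewrite PC QS P12 Q12.
split; last first.
  move=> h Rh _; rewrite cyganE -(ger0_norm d0) -sqrtr_sqr d2 ler_wsqrtr//.
  by apply: (herm_upper _ o p h _ P Q) r0 P0 Q0 (ltW m0) PQ1 m4 pE' (oR _ Rh).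
(* The squares are the cube roots of [cos alpha] and [sin alpha]. *)
have [||h [tau [hr hE tE hd]]] := @farthest_point K o p rho (P ^+ 2) (Q ^+ 2) r0.
- by rewrite -!exprM.
- by rewrite pE' -!exprM.
have cE : normc (herm (std_lift p) (std_lift h)) = 2 * rho * m ^+ 6.
  apply/eqP; rewrite -(eqrXn2 (_ : 0 < 2)%N) ?normc_ge0//; last first.
    by rewrite !mulr_ge0 ?exprn_ge0 ?(ltW r0) ?(ltW m0).
  by apply/eqP; rewrite hd -!exprM -m4; ring.
exists h; split.
- apply: (inR p h tau) => //; apply/normr_eq_inv; exact: hr.
(* The attained distance is positive, so the point found differs from [p]. *)
- move=> hp; move: cE; rewrite hp (null_std_lift K p).2 ComplexField.Normc.normc0.
  by move/esym/eqP; rewrite gt_eqF// ?mulr_gt0// exprn_gt0.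
- by rewrite cyganE cE -d2 sqrtr_sqr ger0_norm.
Qed.
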